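(* Let $\Phi$ be a quantum channel on $n$ qubits, let $\rho$ be an $n$-qubit state (so $\Phi(\rho)$ is the output of a noisy quantum device), and let $\sigma>0$ be a full-rank $n$-qubit state. Put $H_\infty=-\log(\sigma)$ and $D(\Phi(\rho)\|\sigma)=\mathrm{tr}\left(\Phi(\rho)(\log(\Phi(\rho))-\log(\sigma))\right)$. Then for every nonzero Hamiltonian $H$ on $n$ qubits and every $\epsilon>0$ there is a $\lambda\in[0,D(\Phi(\rho)\|\sigma)]$ such that the state $$\tilde\sigma=\frac{\exp\left(-H_\infty-\frac{4\lambda}{\|H\|\epsilon}H\right)}{\mathcal Z},\qquad \mathcal Z=\mathrm{tr}\left(\exp\left(-H_\infty-\tfrac{4\lambda}{\|H\|\epsilon}H\right)\right),$$ satisfies $$\mathrm{tr}\left(H(\tilde\sigma-\Phi(\rho))\right)\le\|H\|\epsilon .$$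
   Context: States are positive semidefinite trace-one operators on $(\mathbb C^2)^{\otimes n}$; Hamiltonians are Hermitian operators; $\|\cdot\|$ is the operator norm; $\log$ is the natural logarithm. *)

(* Defs.v *)
From HB Require Import structures.
From mathcomp Require Import all_boot all_order all_algebra.
From mathcomp Require Export spectral complex.
From mathcomp Require Import classical_sets reals sequences exp.

Set Implicit Arguments.
Unset Strict Implicit.
Unset Printing Implicit Defensive.

Import Order.TTheory GRing.Theory Num.Theory.

Local Open Scope ring_scope.
Local Open Scope sesquilinear_scope.
Local Open Scope complex_scope.
Local Open Scope classical_set_scope.

(* Operators on an [n]-qubit system are matrices of size [2 ^ n], in the
   computational basis; the definitions below are for an arbitrary dimension.
   On [R[i]], [x <= y] means that [y - x] is real and nonnegative. *)

Definition psdmx (R : realType) (d : nat) (A : 'M[R[i]]_d) : Prop :=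
  A \is hermsymmx /\ forall v : 'cV[R[i]]_d, 0 <= (v ^t* *m A *m v) 0 0.

Definition posdefmx (R : realType) (d : nat) (A : 'M[R[i]]_d) : Prop :=
  A \is hermsymmx /\
  forall v : 'cV[R[i]]_d, v != 0 -> 0 < (v ^t* *m A *m v) 0 0.

Definition is_state (R : realType) (d : nat) (A : 'M[R[i]]_d) : Prop :=
  psdmx A /\ \tr A = 1.

(* The map [id (x) Phi] on [M_k (x) M_d], whose elements are seen as
   [k * k] arrays of [d * d] blocks. *)
Definition ampliation (R : realType) (d k : nat)
    (Phi : 'M[R[i]]_d -> 'M[R[i]]_d)
    (X : 'M[R[i]]_(\sum_(i < k) d)) : 'M[R[i]]_(\sum_(i < k) d) :=
  \mxblock_(i, j) Phi (submxblock X i j).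

Definition completely_positive (R : realType) (d : nat)
    (Phi : 'M[R[i]]_d -> 'M[R[i]]_d) : Prop :=
  forall (k : nat) (X : 'M[R[i]]_(\sum_(i < k) d)),
    psdmx X -> psdmx (ampliation Phi X).

Definition is_channel (R : realType) (d : nat)
    (Phi : {linear 'M[R[i]]_d -> 'M[R[i]]_d}) : Prop :=
  completely_positive Phi /\ forall X : 'M[R[i]]_d, \tr (Phi X) = \tr X.

(* Functional calculus, meaningful for Hermitian [A]: [f] is applied to the
   (real) eigenvalues of [A] in an orthonormal eigenbasis. *)
Definition hermfun (R : realType) (d : nat) (f : R -> R) (A : 'M[R[i]]_d) :
    'M[R[i]]_d :=
  invmx (spectralmx A)
    *m diag_mx (map_mx (fun z : R[i] => (f (complex.Re z))%:C) (spectral_diag A))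
    *m spectralmx A.

Definition expmx (R : realType) (d : nat) (A : 'M[R[i]]_d) : 'M[R[i]]_d :=
  hermfun (@expR R) A.

(* [ln 0 = 0], so that on a singular state the logarithm is taken on the
   support, which gives the convention [0 log 0 = 0] for entropies. *)
Definition logmx (R : realType) (d : nat) (A : 'M[R[i]]_d) : 'M[R[i]]_d :=
  hermfun (@ln R) A.

Definition relent (R : realType) (d : nat) (rho sigma : 'M[R[i]]_d) : R[i] :=
  \tr (rho *m (logmx rho - logmx sigma)).

Definition l2norm (R : realType) (d : nat) (v : 'cV[R[i]]_d) : R :=
  Num.sqrt (\sum_(i < d) ComplexField.Normc.normc (v i 0) ^+ 2).

Definition opnorm (R : realType) (d : nat) (A : 'M[R[i]]_d) : R :=
  sup [set l2norm (A *m v) | v in [set v : 'cV[R[i]]_d | l2norm v <= 1]].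

(* Main.v *)
(* Write [A = log sigma - c H], [sigma_c = exp A / Z] and [tau = Phi rho]. Klein's
   inequality gives [0 <= D(tau || sigma_c)] and [0 <= D(sigma_c || sigma)], and
   in their sum the terms [log Z] cancel, leaving
   [c * tr (H (sigma_c - tau)) <= D(tau || sigma)].
   Taking [lam] to be the relative entropy [D] itself makes
   [c = 4 D / (||H|| eps)], hence the trace is at most [||H|| eps / 4] when [D > 0].
   When [D = 0] also [c = 0]; the two inequalities then force [log Z = 0], and the
   equality case of Klein's inequality yields [sigma_c = tau]. *)

Require Import Defs.
From HB Require Import structures.
From mathcomp Require Import all_boot all_order all_algebra.
From mathcomp Require Import spectral complex reals.
From mathcomp Require Import classical_sets sequences exp ring lra.

Set Implicit Arguments.
Unset Strict Implicit.
Unset Printing Implicit Defensive.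

Import Order.TTheory GRing.Theory Num.Theory.

Local Open Scope ring_scope.
Local Open Scope complex_scope.
Local Open Scope sesquilinear_scope.

(** * Adjoints, and positivity of channel outputs *)

Lemma hermsymmxP (R : realType) (d : nat) (A : 'M[R[i]]_d) :
  (A \is hermsymmx) <-> A = A^t*.
Proof.
by split=> [/is_hermitianmxP|h]; [|apply/is_hermitianmxP];
  rewrite expr0 scale1r.
Qed.

Lemma trmxCM (R : realType) (m n p : nat) (A : 'M[R[i]]_(m, n))
    (B : 'M[R[i]]_(n, p)) : (A *m B)^t* = B^t* *m A^t*.
Proof. by rewrite trmx_mul map_mxM. Qed.

Lemma conjC_real_complex (R : realType) (x : R) : (x%:C)^*%R = x%:C.
Proof. by apply/CrealP; rewrite complex_real. Qed.

(* [f] need not be injective: with [f] forgetting the block index, this says that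
   the block matrix all of whose blocks are [A] is positive semidefinite. *)
Lemma psdmx_mxsub (R : realType) (d m : nat) (f : 'I_m -> 'I_d)
    (A : 'M[R[i]]_d) : psdmx A -> psdmx (mxsub f f A).
Proof.
case=> hA pA; split.
  apply/hermsymmxP; move/hermsymmxP: hA => {1}->.
  by apply/matrixP=> i j; rewrite !mxE.
(* With [S = rowsub f 1%:M] the submatrix is [S *m A *m S^t*], so its form at [v] is that of [A] at
   [w]. *)
move=> v; pose w := (rowsub f 1%:M)^t* *m v.
suff -> : v^t* *m mxsub f f A *m v = w^t* *m A *m w by exact: pA.
rewrite /w trmxCM trmxCK !mulmxA -[_ *m rowsub f _ *m A]mulmxA
  mul_rowsub_mx mul1mx.
congr (_ *m _); rewrite -mulmxA; congr (_ *m _).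
apply/matrixP=> i j; rewrite !mxE (bigD1 (f j)) //= big1 => [|k kj].
  by rewrite !mxE eqxx conjC1 mulr1 addr0.
by rewrite !mxE eq_sym (negbTE kj) conjC0 mulr0.
Qed.

(** Complete positivity at [k = 1]: reindexing by [tagnat.sig2] turns [A] into a one-block matrix,
    and reindexing by [tagnat.Rank] extracts the block again. *)
Lemma channel_psd (R : realType) (d : nat)
    (Phi : {linear 'M[R[i]]_d -> 'M[R[i]]_d}) (A : 'M[R[i]]_d) :
  completely_positive Phi -> psdmx A -> psdmx (Phi A).
Proof.
move=> /(_ 1 (\mxblock_(i, j) A)) cp pA.
have /(psdmx_mxsub (@tagnat.Rank 1 (fun=> d) ord0)) :
    psdmx (ampliation Phi (\mxblock_(i < 1, j < 1) A)).
  exact/cp/(psdmx_mxsub (@tagnat.sig2 1 (fun=> d))).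
by rewrite -/(submxblock _ ord0 ord0) /ampliation !mxblockK.
Qed.

Lemma mxtraceB (R : realType) (d : nat) (X Y : 'M[R[i]]_d) :
  \tr (X - Y) = \tr X - \tr Y.
Proof. exact: linearB. Qed.

(** * Functional calculus in an eigenbasis *)

Section Hermfun.
Variables (R : realType) (d : nat).
Implicit Types (A M N : 'M[R[i]]_d) (f g : R -> R).

Definition eigval A (i : 'I_d) : R := complex.Re (spectral_diag A 0 i).

Lemma invmx_spectral A : invmx (spectralmx A) = (spectralmx A)^t*.
Proof. exact/invmx_unitary/spectral_unitarymx. Qed.

(** Common form of all functions of [A], with the adjoint as inverse; identities between them reduce
    to entries of [v]. *)
Definition ofdiag A (v : 'rV[R[i]]_d) : 'M[R[i]]_d :=
  (spectralmx A)^t* *m diag_mx v *m spectralmx A.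

Lemma hermfun_ofdiag f A : hermfun f A = ofdiag A (\row_i (f (eigval A i))%:C).
Proof.
rewrite /hermfun invmx_spectral -/(ofdiag A _).
by congr ofdiag; apply/rowP=> i; rewrite !mxE.
Qed.

Lemma hermfunE f A : hermfun f A =
  (spectralmx A)^t* *m diag_mx (\row_i (f (eigval A i))%:C) *m spectralmx A.
Proof. exact: hermfun_ofdiag. Qed.

Lemma eq_hermfun f g A : (forall i, f (eigval A i) = g (eigval A i)) ->
  hermfun f A = hermfun g A.
Proof.
by move=> fg; rewrite !hermfun_ofdiag; congr ofdiag; apply/rowP=> i; rewrite !mxE fg.
Qed.

Lemma hermfun_id A : A \is hermsymmx -> hermfun id A = A.
Proof.
move=> hA; have /orthomx_spectralP {2}-> := hermitian_normalmx hA.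
rewrite hermfun_ofdiag invmx_spectral -/(ofdiag A _).
congr ofdiag; apply/rowP=> i; rewrite !mxE RRe_real //.
by have /mxOverP := hermitian_spectral_diag_real hA.
Qed.

Lemma hermfun_herm f A : hermfun f A \is hermsymmx.
Proof.
apply/hermsymmxP; rewrite hermfunE !trmxCM trmxCK mulmxA.
rewrite tr_diag_mx map_diag_mx -!/(ofdiag A _); congr ofdiag; apply/rowP=> i.
by rewrite !mxE; apply/esym; exact: conjC_real_complex.
Qed.

Lemma hermfun_psd f A : (forall i, 0 <= f (eigval A i)) -> psdmx (hermfun f A).
Proof.
move=> f0; split=> [|v]; first exact: hermfun_herm.
rewrite hermfunE !mulmxA -[_ *m spectralmx A *m v]mulmxA.
(* In eigenbasis coordinates [w] the form is the sum of the [|w_i|^2] weighted by [f] of the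
   eigenvalues. *)
set w := spectralmx A *m v; rewrite -[v^t* *m _]trmxCK trmxCM !trmxCK -/w.
rewrite mul_mx_diag mxE sumr_ge0 // => i _; rewrite !mxE mulrAC.
by rewrite mulr_ge0 ?ler0c // mulrC -normCK exprn_ge0.
Qed.

Lemma hermfunZ (a : R) f A :
  hermfun (fun x => a * f x) A = a%:C *: hermfun f A.
Proof.
rewrite [in RHS]hermfunE scalemxAl scalemxAr -linearZ /= -/(ofdiag A _) hermfun_ofdiag.
congr ofdiag; apply/rowP=> i.
by rewrite !mxE rmorphM.
Qed.

Lemma hermfun_shift (a : R) f A :
  hermfun (fun x => f x - a) A = hermfun f A - (a%:C)%:M.
Proof.
have -> : (a%:C)%:M = (spectralmx A)^t* *m (a%:C)%:M *m spectralmx A.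
  rewrite mul_mx_scalar -scalemxAl -invmx_spectral.
  by rewrite mulVmx ?spectral_unit // scalemx1.
rewrite [in RHS]hermfunE -mulmxBl -mulmxBr -diag_const_mx -linearB /=.
rewrite -/(ofdiag A _) hermfun_ofdiag; congr ofdiag; apply/rowP=> i.
by rewrite !mxE rmorphB.
Qed.

Lemma eigvalE A i : A \is hermsymmx ->
  (eigval A i)%:C = ((spectralmx A) *m A *m (spectralmx A)^t*) i i.
Proof.
move=> hA; rewrite -{3}(hermfun_id hA) hermfunE !mulmxA.
rewrite (unitarymxP (spectral_unitarymx A)) mul1mx mulmxtVK ?spectral_unitarymx //.
by rewrite !mxE eqxx mulr1n.
Qed.

(** Evaluating the quadratic form at an eigenvector lets positivity of the form pass to
    eigenvalues. *)
Lemma eigval_row A i : A \is hermsymmx -> let v := (row i (spectralmx A))^t* in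
  (eigval A i)%:C = (v^t* *m A *m v) 0 0.
Proof.
move=> hA v; rewrite eigvalE // /v trmxCK !mxE; apply: eq_bigr => j _.
by rewrite -row_mul !mxE.
Qed.

Lemma psd_eigval_ge0 A i : psdmx A -> 0 <= eigval A i.
Proof. by case=> hA pA; rewrite -ler0c eigval_row. Qed.

Lemma posdef_eigval_gt0 A i : posdefmx A -> 0 < eigval A i.
Proof.
case=> hA pA; rewrite -ltcR eigval_row //; apply: pA.
apply/eqP=> v0.
have /unitarymxP/matrixP/(_ i i) := spectral_unitarymx A.
move: v0 => /matrixP v0.
rewrite !mxE eqxx big1 => [/eqP|k _]; first by rewrite eq_sym oner_eq0.
by have := v0 k 0; rewrite !mxE => ->; rewrite mulr0.
Qed.

(** * Overlaps of two eigenbases, and Klein's inequality *)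

(** Squared modulus of the inner product of two eigenvectors, a transition probability; the real
    part only moves it to [R]. *)
Definition overlap M N (i j : 'I_d) : R :=
  complex.Re (`|(spectralmx M *m (spectralmx N)^t*) i j| ^+ 2).

Lemma overlapE M N i j :
  (overlap M N i j)%:C = `|(spectralmx M *m (spectralmx N)^t*) i j| ^+ 2.
Proof. by rewrite RRe_real // ger0_real // exprn_ge0. Qed.

Lemma overlap_ge0 M N i j : 0 <= overlap M N i j.
Proof. by rewrite -ler0c overlapE exprn_ge0. Qed.

Lemma overlap_row M N i : \sum_j overlap M N i j = 1.
Proof.
apply: (@complexI R); rewrite rmorph_sum /=.
have uW : spectralmx M *m (spectralmx N)^t* \is unitarymx.
  by rewrite mul_unitarymx ?trmxC_unitary ?spectral_unitarymx.
have /unitarymxP/matrixP/(_ i i) := uW.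
rewrite !mxE eqxx => W1; apply: etrans W1; apply: eq_bigr => j _.
by rewrite overlapE normCK !mxE.
Qed.

Lemma overlapC M N i j : overlap M N i j = overlap N M j i.
Proof.
apply: (@complexI R); rewrite !overlapE -[in LHS]norm_conjC; congr (`|_| ^+ 2).
have -> : spectralmx N *m (spectralmx M)^t* = (spectralmx M *m (spectralmx N)^t*)^t*.
  by rewrite trmxCM trmxCK.
by rewrite [in RHS]mxE [in RHS]mxE.
Qed.

Lemma overlap_col M N j : \sum_i overlap M N i j = 1.
Proof. by under eq_bigr do rewrite overlapC; exact: overlap_row. Qed.

Lemma tr_hermfun f A : \tr (hermfun f A) = (\sum_i f (eigval A i))%:C.
Proof.
rewrite hermfunE -mulmxA mxtrace_mulC -mulmxA (unitarymxP (spectral_unitarymx A)) mulmx1.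
by rewrite mxtrace_diag rmorph_sum; apply: eq_bigr => i _; rewrite mxE.
Qed.

Lemma ofdiagM A u v :
  ofdiag A u *m ofdiag A v = ofdiag A (\row_i (u 0 i * v 0 i)).
Proof.
have := unitarymxP (spectral_unitarymx A).
rewrite /ofdiag; move: (spectralmx A) => P PP; rewrite -mulmx_diag -!mulmxA.
by congr (_ *m (_ *m _)); rewrite !mulmxA PP mul1mx.
Qed.

Lemma hermfunM f g A : hermfun f A *m hermfun g A = hermfun (fun x => f x * g x) A.
Proof.
rewrite !hermfun_ofdiag ofdiagM; congr ofdiag; apply/rowP=> i.
by rewrite !mxE rmorphM.
Qed.

Lemma tr_hermfun_mul f g M N : \tr (hermfun f M *m hermfun g N) =
  (\sum_i \sum_j overlap M N i j * (f (eigval M i) * g (eigval N j)))%:C.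
Proof.
rewrite !hermfunE !mulmxA mxtrace_mulC !mulmxA.
pose W := spectralmx M *m (spectralmx N)^t*.
have WE : spectralmx N *m (spectralmx M)^t* = W^t* by rewrite trmxCM trmxCK.
rewrite WE -[_ *m spectralmx M *m _]mulmxA -/W /mxtrace exchange_big rmorph_sum.
apply: eq_bigr => j _; rewrite mul_mx_diag mul_mx_diag !mxE rmorph_sum mulr_suml.
apply: eq_bigr => i _; rewrite /= !rmorphM /= overlapE -/W normCK !mxE.
by ring.
Qed.

(* The nonnegative integrand of Klein's inequality for [a] against [expR l]; the
   convention [ln 0 = 0] makes it [expR l] at [a = 0]. *)
Definition klein (a l : R) := a * ln a - a * l - a + expR l.

(** For [a > 0], multiply [1 + x <= expR x] at [x = l - ln a] by [a]. *)
Lemma klein_ge0 a l : 0 <= a -> 0 <= klein a l.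
Proof.
rewrite /klein le0r => /predU1P[->|a0]; first by rewrite !mul0r !subr0 add0r expR_ge0.
have := expR_ge1Dx (l - ln a); rewrite expRB lnK ?posrE // => h.
have : a * (1 + (l - ln a)) <= expR l.
  by rewrite -[leRHS](mulfVK (lt0r_neq0 a0)) mulrC ler_pM2r.
by lra.
Qed.

(** The exponential inequality is strict unless [l = ln a]; at [a = 0] the assumption already reads
    [expR l = 0]. *)
Lemma klein_eq0 a l : 0 <= a -> klein a l = 0 -> a = expR l.
Proof.
rewrite /klein le0r => /predU1P[->|a0].
  by rewrite !mul0r !subr0 add0r.
have [<-|ne] := eqVneq (ln a) l; first by rewrite lnK ?posrE.
have : l - ln a != 0 by rewrite subr_eq0 eq_sym.
move=> /expR_gt1Dx; rewrite expRB lnK ?posrE // => h.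
have : a * (1 + (l - ln a)) < expR l.
  by rewrite -[ltRHS](mulfVK (lt0r_neq0 a0)) mulrC ltr_pM2r.
by lra.
Qed.

(* Doubly stochastic overlaps turn the trace of each operator into a double sum,
   so that all terms can be compared entrywise. *)
Lemma klein_trace f g M N :
  \tr (hermfun f M *m (hermfun (fun x => ln (f x)) M - hermfun g N))
    - \tr (hermfun f M) + \tr (hermfun (fun x => expR (g x)) N) =
  (\sum_i \sum_j overlap M N i j * klein (f (eigval M i)) (g (eigval N j)))%:C.
Proof.
have := tr_hermfun (fun x => f x * ln (f x)) M; rewrite -hermfunM.
have := tr_hermfun f M; have := tr_hermfun (fun x => expR (g x)) N.
have := tr_hermfun_mul f g M N.
move: (hermfun f M) (hermfun g N) (hermfun _ M) (hermfun _ N) => a b ? ?.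
move=> E1 E2 E3 E4; rewrite mulmxBr mxtraceB E1 E2 E3 E4.
rewrite -!(rmorphB, rmorphD) /=; congr (_%:C).
have EM (F : R -> R) : \sum_i F (eigval M i) =
    \sum_i \sum_j overlap M N i j * F (eigval M i).
  by apply: eq_bigr => i _; rewrite -mulr_suml overlap_row mul1r.
have EN (F : R -> R) : \sum_j F (eigval N j) =
    \sum_i \sum_j overlap M N i j * F (eigval N j).
  by rewrite exchange_big; apply: eq_bigr => j _; rewrite -mulr_suml overlap_col mul1r.
rewrite (EM (fun x => f x * ln (f x))) EM (EN (fun x => expR (g x))).
rewrite -!(sumrB, big_split) /=; apply: eq_bigr => i _.
rewrite -!(sumrB, big_split) /=; apply: eq_bigr => j _.
by rewrite /klein; ring.
Qed.

Lemma klein_trace_ge0 f g M N : (forall i, 0 <= f (eigval M i)) ->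
  \tr (hermfun f M) - \tr (hermfun (fun x => expR (g x)) N) <=
  \tr (hermfun f M *m (hermfun (fun x => ln (f x)) M - hermfun g N)).
Proof.
move=> f0; rewrite -subr_ge0 opprB addrA addrAC klein_trace ler0c.
by do 2![apply: sumr_ge0 => ? _]; rewrite mulr_ge0 ?overlap_ge0 ?klein_ge0.
Qed.

Lemma intertwine (P Q D E : 'M[R[i]]_d) :
  P^t* *m P = 1%:M -> Q^t* *m Q = 1%:M ->
  D *m (P *m Q^t*) = P *m Q^t* *m E -> P^t* *m D *m P = Q^t* *m E *m Q.
Proof.
move=> PP QQ h; rewrite -[LHS]mulmx1 -QQ !mulmxA -(mulmxA _ P) -(mulmxA _ D).
by rewrite h !mulmxA PP mul1mx.
Qed.

(** By [intertwine], it suffices that the change of basis [W] satisfies [f(m_i) W_ij = W_ij g(n_j)]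
    for the eigenvalues [m_i], [n_j]; this is trivial where [W_ij] vanishes. *)
Lemma eq_hermfun_overlap f g M N :
  (forall i j, overlap M N i j != 0 -> f (eigval M i) = g (eigval N j)) ->
  hermfun f M = hermfun g N.
Proof.
move=> fg; rewrite !hermfunE.
apply: intertwine; try by rewrite -invmx_spectral mulVmx ?spectral_unit.
rewrite mul_diag_mx mul_mx_diag; apply/matrixP=> i j; rewrite [LHS]mxE [RHS]mxE.
have [o0|/fg e] := eqVneq (overlap M N i j) 0; last first.
  by rewrite ![(\row__ _) _ _]mxE e mulrC.
have /eqP : `|(spectralmx M *m (spectralmx N)^t*) i j| ^+ 2 = 0.
  by rewrite -overlapE o0.
by rewrite expf_eq0 normr_eq0 /= => /eqP ->; rewrite mulr0 mul0r.
Qed.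

(** Equality makes a double sum of nonnegative terms vanish, so the Klein integrand is zero wherever
    the overlap is not. *)
Lemma klein_trace_eq f g M N : (forall i, 0 <= f (eigval M i)) ->
  \tr (hermfun f M *m (hermfun (fun x => ln (f x)) M - hermfun g N)) =
  \tr (hermfun f M) - \tr (hermfun (fun x => expR (g x)) N) ->
  hermfun f M = hermfun (fun x => expR (g x)) N.
Proof.
move=> f0 /eqP; rewrite -subr_eq0 opprB addrA addrAC klein_trace => /eqP s0.
have {}s0 := complexI s0.
have k0 i j : 0 <= overlap M N i j * klein (f (eigval M i)) (g (eigval N j)).
  by rewrite mulr_ge0 ?overlap_ge0 ?klein_ge0.
apply: eq_hermfun_overlap => i j o0; apply: klein_eq0 => //.
move: s0 => /psumr_eq0P/(_ i isT) s0.
have /psumr_eq0P/(_ j isT)/eqP := s0 (fun i _ => sumr_ge0 _ (fun j _ => k0 i j)).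
by rewrite mulf_eq0 (negbTE o0) => /(_ (fun j _ => k0 i j))/eqP.
Qed.

End Hermfun.

Lemma relent_ge0 (R : realType) (d : nat) (A B : 'M[R[i]]_d) :
  is_state A -> is_state B -> posdefmx B -> 0 <= relent A B.
Proof.
move=> [pA trA] [_ tr_B] pB; have [hA _] := pA; have [hB _] := pB.
have := @klein_trace_ge0 R d id (@ln R) A B (fun i => psd_eigval_ge0 i pA).
(* Full rank enters here: [expR (ln x) = x] needs positive eigenvalues. *)
rewrite (@eq_hermfun _ _ (fun x => expR (ln x)) id); last first.
  by move=> i; rewrite lnK ?posrE ?posdef_eigval_gt0.
by rewrite !hermfun_id // trA tr_B subrr.
Qed.

(** * Gibbs states and the energy inequality *)

Section Gibbs.
Variables (R : realType) (d : nat) (tau sigma H : 'M[R[i]]_d) (c : R).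
Hypotheses (d_gt0 : (0 < d)%N) (tau_state : is_state tau).
Hypotheses (sigma_state : is_state sigma) (sigma_pos : posdefmx sigma).
Hypothesis H_herm : H \is hermsymmx.

Let A := logmx sigma - c%:C *: H.
Let gibbs := (\tr (expmx A))^-1 *: expmx A.
Let z := ln (\sum_i expR (eigval A i)).

Let A_herm : A \is hermsymmx.
Proof.
apply/hermsymmxP; have /hermsymmxP hK := hermfun_herm (@ln R) sigma.
rewrite /A /logmx {1}hK {1}(hermsymmxP H).1 //; apply/matrixP => i j.
rewrite !mxE rmorphB rmorphM /=; congr (_ - _ * _).
by apply/esym; exact: conjC_real_complex.
Qed.

Let partition_gt0 : 0 < \sum_i expR (eigval A i).
Proof.
rewrite (bigD1 (Ordinal d_gt0)) //= ltr_pwDl ?expR_gt0 //.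
by rewrite sumr_ge0 // => i _; exact: expR_ge0.
Qed.

(** Moving the normalization into the exponent, [z] being the log-partition function, gives the
    exponential form required by Klein's inequality. *)
Let gibbsE : gibbs = hermfun (fun x => expR (x - z)) A.
Proof.
rewrite /gibbs /expmx tr_hermfun -fmorphV -hermfunZ; apply: eq_hermfun => i.
by rewrite expRB /z lnK ?posrE ?partition_gt0 // mulrC.
Qed.

Lemma gibbs_is_state : is_state gibbs.
Proof.
split; first by rewrite gibbsE; apply: hermfun_psd => i; exact: expR_ge0.
rewrite /gibbs linearZ /= mulVf // tr_hermfun.
by rewrite (inj_eq (@complexI R) _ 0) lt0r_neq0 ?partition_gt0.
Qed.

(** The logarithm of [gibbs], written through [A] so that no eigenbasis of [gibbs] itself has to be
    compared with that of [A]. *)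
Let L := A - (z%:C)%:M.

Let LE : hermfun (fun x => x - z) A = L.
Proof. by rewrite hermfun_shift hermfun_id. Qed.

Let tr_mulL (rho : 'M[R[i]]_d) : \tr rho = 1 ->
  \tr (rho *m (L - logmx sigma)) = - (c%:C * \tr (H *m rho)) - z%:C.
Proof.
move=> tr1; have -> : L - logmx sigma = - (c%:C *: H) - (z%:C)%:M.
  by rewrite /L /A addrAC [_ - logmx _]addrAC subrr add0r.
rewrite mulmxBr mulmxN -scalemxAr mul_mx_scalar mxtraceB mxtraceZ tr1 mulr1.
by rewrite linearN /= mxtraceZ mxtrace_mulC.
Qed.

(** This is [D(tau || gibbs)]; both traces in Klein's inequality equal 1. *)
Let klein_tau : 0 <= \tr (tau *m (logmx tau - L)).
Proof.
have [[hA pA] tr1] := tau_state.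
have := @klein_trace_ge0 R d id (fun x => x - z) tau A
  (fun i => psd_eigval_ge0 i (conj hA pA)).
by rewrite (hermfun_id hA) tr1 LE -gibbsE gibbs_is_state.2 subrr.
Qed.

(** This is [D(gibbs || sigma)], with [f] the normalized exponential on [A] and [g] the logarithm on
    [sigma]. *)
Let klein_gibbs : 0 <= \tr (gibbs *m (L - logmx sigma)).
Proof.
have [hs _] := sigma_pos.
have := @klein_trace_ge0 R d (fun x => expR (x - z)) (@ln R) A sigma
  (fun i => expR_ge0 _).
rewrite (@eq_hermfun _ _ (fun x => expR (ln x)) id); last first.
  by move=> i; rewrite lnK ?posrE ?posdef_eigval_gt0.
rewrite (@eq_hermfun _ _ (fun x => ln (expR (x - z))) (fun x => x - z)); last first.
  by move=> i; rewrite expRK.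
by rewrite (hermfun_id hs) LE -gibbsE gibbs_is_state.2 sigma_state.2 subrr.
Qed.

Let relentE : relent tau sigma =
  \tr (tau *m (logmx tau - L)) + \tr (tau *m (L - logmx sigma)).
Proof. by rewrite -linearD /= -mulmxDr addrA subrK. Qed.

(** The difference of the two sides is exactly [D(tau || gibbs) + D(gibbs || sigma)]. *)
Lemma gibbs_energy_le :
  c%:C * \tr (H *m (gibbs - tau)) <= relent tau sigma.
Proof.
rewrite relentE (tr_mulL tau_state.2) -subr_ge0.
have := addr_ge0 klein_tau klein_gibbs; rewrite (tr_mulL gibbs_is_state.2).
have -> : \tr (H *m (gibbs - tau)) = \tr (H *m gibbs) - \tr (H *m tau).
  by rewrite mulmxBr mxtraceB.
by congr (0 <= _); move: (\tr _) (\tr _) (\tr _) => t1 t2 t3; ring.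
Qed.

Lemma gibbs_eq_state : c = 0 -> relent tau sigma = 0 -> gibbs = tau.
Proof.
move=> c0 D0; have := klein_tau; have := klein_gibbs.
have := relentE; rewrite D0 !tr_mulL ?tau_state.2 ?gibbs_is_state.2 //.
rewrite c0 !mul0r !oppr0 !add0r.
move=> e z0 t0.
(* Here [e] identifies the trace with [z], while [z0] gives [z <= 0] and [t0] the opposite sign. *)
have te : \tr (tau *m (logmx tau - L)) = 0.
  apply/le_anti; rewrite t0 andbT.
  by move/eqP: e; rewrite eq_sym subr_eq0 => /eqP ->; rewrite -oppr_ge0.
have [[hA pA] tr1] := tau_state.
have := @klein_trace_eq R d id (fun x => x - z) tau A
  (fun i => psd_eigval_ge0 i (conj hA pA)).
rewrite hermfun_id // tr1 LE -gibbsE gibbs_is_state.2 subrr.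
by move=> /(_ te).
Qed.

End Gibbs.

(** * Positivity of the operator norm *)

Lemma normc_sum (R : realType) (I : finType) (F : I -> R[i]) :
  ComplexField.Normc.normc (\sum_i F i) <=
  \sum_i ComplexField.Normc.normc (F i).
Proof.
elim/big_rec2: _ => [|i y x _ h]; first by rewrite ComplexField.Normc.normc0.
by apply: le_trans (le_normcD _ _) _; rewrite lerD2l.
Qed.

Lemma opnorm_gt0 (R : realType) (n : nat) (A : 'M[R[i]]_n) :
  A != 0 -> 0 < opnorm A.
Proof.
move=> /matrix0Pn[i [j Aij]].
have l0 z : 0 <= ComplexField.Normc.normc z :> R.
  by case: z => a b; exact: sqrtr_ge0.
have nvj (v : 'cV[R[i]]_n) k : l2norm v <= 1 ->
    ComplexField.Normc.normc (v k 0) <= 1.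
  move=> v1; apply: le_trans v1; rewrite -[leLHS]ger0_norm // -sqrtr_sqr.
  rewrite ler_wsqrtr // [leRHS](bigD1 k) //= lerDl sumr_ge0 // => l _.
  exact: sqr_ge0.
(* A basis vector selecting a column with a nonzero entry is a unit vector with nonzero image. *)
apply: (@lt_le_trans _ _ (l2norm (A *m delta_mx j 0))).
  rewrite /l2norm sqrtr_gt0 (bigD1 i) //= ltr_pwDl ?sumr_ge0 //;
    last by move=> k _; exact: sqr_ge0.
  rewrite -colE !mxE exprn_gt0 // lt_def l0 andbT.
  by apply: contraNneq Aij => /ComplexField.Normc.eq0_normc ->.
apply: ub_le_sup; last first.
  exists (delta_mx j 0) => //=; rewrite /l2norm (bigD1 j) //= big1 => [|k kj].
    by rewrite !mxE !eqxx ComplexField.Normc.normc1 expr1n addr0 sqrtr1.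
  by rewrite !mxE (negbTE kj) ComplexField.Normc.normc0 expr0n.
(* The supremum bounds its set only if that set is bounded: entries of [v] have modulus at most 1,
   so row sums of moduli suffice. *)
exists (Num.sqrt (\sum_i (\sum_j ComplexField.Normc.normc (A i j)) ^+ 2)).
move=> _ [v /= v1 <-]; rewrite ler_wsqrtr // ler_sum // => k _.
rewrite lerXn2r ?nnegrE ?sumr_ge0 // mxE (le_trans (normc_sum _)) // ler_sum // => l _.
by rewrite ComplexField.Normc.normcM ler_piMr // nvj.
Qed.

(** * The energy bound, with [lam] at the upper endpoint *)

Theorem lemma5 (R : realType) (n : nat)
    (Phi : {linear 'M[R[i]]_(2 ^ n) -> 'M[R[i]]_(2 ^ n)})
    (rho sigma : 'M[R[i]]_(2 ^ n)) :
  is_channel Phi -> is_state rho -> is_state sigma -> posdefmx sigma ->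
  let Hinf := - logmx sigma in
  let D := relent (Phi rho) sigma in
  forall (H : 'M[R[i]]_(2 ^ n)) (eps : R),
    H \is hermsymmx -> H != 0 -> 0 < eps ->
    exists lam : R, [/\ 0 <= lam, lam%:C <= D &
      let G := expmx (- Hinf - (4 * lam / (opnorm H * eps))%:C *: H) in
      let Z := \tr G in
      let tsigma := Z^-1 *: G in
      is_state tsigma /\
      \tr (H *m (tsigma - Phi rho)) <= (opnorm H * eps)%:C].
Proof.
move=> [cp tp] [psd_rho tr_rho] st_sigma pos_sigma Hinf D H eps hH H0 eps0.
have st_tau : is_state (Phi rho) by split; [exact: channel_psd | rewrite tp].
have D0 : 0 <= D by exact: relent_ge0.
have DE : (complex.Re D)%:C = D by rewrite RRe_real // ger0_real.
have h0 : 0 < opnorm H * eps by rewrite mulr_gt0 // opnorm_gt0.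
have d0 : (0 < 2 ^ n)%N by rewrite expn_gt0.
exists (complex.Re D); split; [by rewrite -ler0c DE | by rewrite DE |].
rewrite /Hinf opprK; set h := opnorm H * eps in h0 *; set c := _ / h.
set tsigma := _ *: expmx _; split; first exact: gibbs_is_state.
have le_D : c%:C * \tr (H *m (tsigma - Phi rho)) <= D by exact: gibbs_energy_le.
(* If [D = 0] then [c = 0] and [le_D] says nothing about the trace, so the equality case takes
   over. *)
have [ReD0|ReD0] := eqVneq (complex.Re D) 0.
  have -> : tsigma = Phi rho.
    by apply: gibbs_eq_state => //; [rewrite /c ReD0 mulr0 mul0r | rewrite -/D -DE ReD0].
  by rewrite subrr mulmx0 linear0 ler0c ltW.
have ReD_gt0 : 0 < complex.Re D by rewrite lt0r ReD0 -ler0c DE.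
have c0 : 0 < c by rewrite /c divr_gt0 // mulr_gt0.
(* After multiplication by [c > 0] the target is [c * h = 4 D], which dominates [D]. *)
rewrite -(@ler_pM2l _ c%:C) ?ltcR //; apply: le_trans le_D _.
rewrite -rmorphM /= /c divfK ?lt0r_neq0 // -DE lecR.
by rewrite ler_peMl ?ler1n // ltW.
Qed.
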